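(* For every $5\le n\le 13$, the following pair of sequences $A=(a_0,\ldots,a_{n-2})$, $B=(b_0,\ldots,b_{n-2})$ forms a geodesic Leech labeling of $W_n$, where $a_i$ is the label of the spoke $uv_i$ and $b_i$ is the label of the rim edge $v_iv_{i+1}$ (indices modulo $n-1$): \begin{itemize} \item $W_5$: $A=(6,2,7,3)$, $B=(1,10,4,8)$; \item $W_6$: $A=(14,7,6,5,11)$, $B=(1,3,13,2,8)$; \item $W_7$: $A=(4,5,2,14,22,7)$, $B=(15,8,17,3,10,1)$; \item $W_8$: $A=(9,6,7,21,13,8,5)$, $B=(10,24,4,31,1,2,23)$; \item $W_9$: $A=(5,8,1,13,34,28,9,3)$, $B=(12,20,24,2,25,15,23,7)$; \item $W_{10}$: $A=(15,4,19,39,29,1,7,13,2)$, $B=(8,10,35,12,25,24,27,23,30)$; \item $W_{11}$: $A=(1,32,33,16,22,9,27,4,29,31)$, $B=(2,44,21,18,6,8,3,12,7,50)$; \item $W_{12}$: $A=(10,31,17,22,26,13,38,39,2,37,3)$, $B=(1,8,66,11,7,14,58,4,67,6,45)$; \item $W_{13}$: $A=(25,10,36,16,30,44,2,42,3,43,46,21)$, $B=(4,7,15,74,1,34,50,20,9,8,6,77)$. \end{itemize} In particular, $W_n$ is geodesic Leech for every $n\in\{5,6,\ldots,13\}$.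
   Context: Graphs are finite, simple, undirected and connected. A geodesic of a graph $G$ is a shortest path between two distinct vertices; a path and its reverse are regarded as the same, but distinct shortest paths with the same endpoints are counted separately. Let $t_{gp}(G)$ be the number of geodesics of $G$. For an edge labeling $f:E(G)\to\{1,2,3,\ldots\}$, the weight of a path is the sum of the labels of its edges. The labeling $f$ is a geodesic Leech labeling if the multiset of the weights of all geodesics of $G$ is exactly $\{1,2,\ldots,t_{gp}(G)\}$, each value occurring once. A graph is geodesic Leech if it admits a geodesic Leech labeling. $W_n$ denotes the wheel on $n$ vertices: a hub $u$ joined to every vertex of a rim cycle $v_0,v_1,\ldots,v_{n-2}$ of length $n-1$ (in cyclic order). *)

(* Defs.v *)
From mathcomp Require Import all_boot.

Set Implicit Arguments.
Unset Strict Implicit.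
Unset Printing Implicit Defensive.

Record graph := Graph {
  vertex :> finType;
  adj : rel vertex;
  adj_sym : symmetric adj;
  adj_irr : irreflexive adj;
  adj_conn : forall x y, connect adj x y
}.

Section Geodesics.

Variable G : graph.

Definition edges : {set {set G}} :=
  [set [set e.1; e.2] | e : G * G & adj e.1 e.2].

(* x :: q is the sequence of vertices of a path of length size q. *)
Definition is_path (x : G) (q : seq G) : bool :=
  path (@adj G) x q && uniq (x :: q).

(* Vertices are not repeated, so #|G|.-bseq G covers all paths. *)
Definition is_shortest (x : G) (q : seq G) : bool :=
  is_path x q &&
  [forall r : #|G|.-bseq G,
     is_path x r && (last x r == last x q) ==> (size q <= size r)].

Definition is_geodesic (x : G) (q : seq G) : bool :=
  is_shortest x q && (x != last x q).

Definition path_edges (x : G) (q : seq G) : {set {set G}} :=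
  [set:: pairmap (fun a b => [set a; b]) x q].

(* A path with at least one edge is determined, up to reversal, by its set of
   edges; taking edge sets thus identifies a path with its reverse and nothing
   else. *)
Definition geodesics : {set {set {set G}}} :=
  [set path_edges p.1 p.2 | p : G * #|G|.-bseq G & is_geodesic p.1 p.2].

Definition t_gp : nat := #|geodesics|.

(* Edge labelings are total functions on sets of vertices; only their values
   on edges are ever used. *)
Definition weight (f : {set G} -> nat) (P : {set {set G}}) : nat :=
  \sum_(E in P) f E.

Definition geodesic_leech_labeling (f : {set G} -> nat) : Prop :=
  {in edges, forall E, 0 < f E} /\
  perm_eq [seq weight f P | P in geodesics] (iota 1 t_gp).

Definition geodesic_leech : Prop := exists f, geodesic_leech_labeling f.

End Geodesics.

Section Wheel.

Variable n : nat.

(* None is the hub, Some i the rim vertex v_i; ordS is the successor modulo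
   n.-1. For n >= 4 the condition i != j is redundant. *)
Definition wheel_adj : rel (option 'I_n.-1) := fun x y =>
  match x, y with
  | None, None => false
  | Some i, Some j => (i != j) && ((j == ordS i) || (i == ordS j))
  | _, _ => true
  end.

Lemma wheel_adj_sym : symmetric wheel_adj.
Proof. by move=> [i|] [j|] //=; rewrite eq_sym orbC. Qed.

Lemma wheel_adj_irr : irreflexive wheel_adj.
Proof. by move=> [i|] //=; rewrite eqxx. Qed.

Lemma wheel_adj_conn x y : connect wheel_adj x y.
Proof.
by apply: (@connect_trans _ _ None); [case: x => [i|] | case: y => [i|]];
  rewrite ?connect0 // connect1.
Qed.

Definition wheel : graph := Graph wheel_adj_sym wheel_adj_irr wheel_adj_conn.

Definition spoke (i : 'I_n.-1) : {set wheel} := [set None; Some i].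

Definition rim (i : 'I_n.-1) : {set wheel} := [set Some i; Some (ordS i)].

Definition wheel_labeling (A B : seq nat) (E : {set wheel}) : nat :=
  if [pick i | E == spoke i] is Some i then nth 0 A i
  else if [pick i | E == rim i] is Some i then nth 0 B i
  else 0.

Lemma wheel_labeling_spoke A B i : wheel_labeling A B (spoke i) = nth 0 A i.
Proof.
rewrite /wheel_labeling; case: pickP => [j /eqP/setP/(_ (Some i))|/(_ i)].
  by rewrite !inE eqxx orbT /= => /esym/eqP[->].
by rewrite eqxx.
Qed.

Lemma wheel_labeling_rim A B i :
  4 <= n -> wheel_labeling A B (rim i) = nth 0 B i.
Proof.
move=> n_ge4; rewrite /wheel_labeling.
case: pickP => [j /eqP/setP/(_ None)|_]; first by rewrite !inE.
case: pickP => [j /eqP eq_ij|/(_ i)]; last by rewrite eqxx.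
congr nth; apply/eqP; apply/negPn/negP => neq_ij.
have ei : i = ordS j.
  move/setP/(_ (Some i)): (eq_ij).
  rewrite !inE eqxx => /esym/orP[/eqP[e]|/eqP[//]].
  by rewrite e eqxx in neq_ij.
have ej : j = ordS i.
  move/setP/(_ (Some j)): (eq_ij).
  rewrite !inE eqxx => /orP[/eqP[e]|/eqP[//]].
  by rewrite e eqxx in neq_ij.
have iS : i = i.+2 %% n.-1 :> nat.
  by rewrite -addn1 -modnDml -[i.+1 %% _]/(val (ordS i)) -ej addn1 {1}ei.
have m_gt2 : 2 < n.-1 by case: (n) n_ge4 => [|[|[|[|]]]].
have : i + 2 == i + 0 %[mod n.-1].
  by rewrite addn0 addn2 -iS modn_small.
by rewrite eqn_modDl !modn_small // (ltn_trans _ m_gt2).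
Qed.

End Wheel.

(* Main.v *)
(** A wheel has diameter 2, so its geodesics are its edges and the paths of
    length 2 between non-adjacent vertices: either two spokes ending at
    non-adjacent rim vertices, or two consecutive rim edges.  The claim is thus
    that an explicit list of sums of labels is a permutation of an initial
    segment of the positive integers, which is checked by computation. *)

Require Import Defs.
From mathcomp Require Import all_boot.

Set Implicit Arguments.
Unset Strict Implicit.
Unset Printing Implicit Defensive.

(** * Geodesics in graphs of diameter at most two *)

Section DiameterTwo.

Variable G : graph.

Hypothesis diam2 : forall x z : G,
  x != z -> adj x z \/ exists2 y, adj x y & adj y z.

Lemma is_path1 (x y : G) : is_path x [:: y] = adj x y.
Proof.
rewrite /is_path /= andbT inE andbT.
by case: eqVneq => [->|_]; rewrite ?adj_irr ?andbT.
Qed.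

Lemma is_path2 (x y z : G) :
  is_path x [:: y; z] = [&& adj x y, adj y z & x != z].
Proof.
rewrite /is_path /= !inE !andbT negb_or.
case: (eqVneq x y) => [->|_]; first by rewrite adj_irr.
case: (eqVneq y z) => [->|_]; first by rewrite adj_irr !andbF.
by rewrite /= andbT andbA.
Qed.

(** This packs any path into [#|G|.-bseq G], the finite type over which [is_shortest] and
    [geodesics] quantify. *)
Lemma is_path_size (x : G) q : is_path x q -> size q <= #|G|.
Proof.
by case/andP=> _ /card_uniqP/= eq_sz; rewrite ltnW // -eq_sz max_card.
Qed.

Lemma is_shortestP (x : G) q :
  reflect (is_path x q /\
           forall r, is_path x r -> last x r = last x q -> size q <= size r)
          (is_shortest x q).
Proof.
apply: (iffP andP) => -[q_path q_min]; split=> //.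
  move=> r r_path eq_last.
  move/forallP/(_ (Bseq (is_path_size r_path))): q_min.
  by rewrite /= r_path eq_last eqxx.
by apply/forallP=> r; apply/implyP=> /andP[r_path /eqP]; apply: q_min.
Qed.

Lemma is_geodesic1 (x y : G) : is_geodesic x [:: y] = adj x y.
Proof.
apply/andP/idP => [[/is_shortestP[]]|adj_xy]; first by rewrite is_path1.
have neq_xy : x != y by apply: contraL adj_xy => /eqP->; rewrite adj_irr.
split=> //; apply/is_shortestP; split; first by rewrite is_path1.
by case=> [|//] _ /= eq_xy; rewrite eq_xy eqxx in neq_xy.
Qed.

Lemma is_geodesic2 (x y z : G) :
  is_geodesic x [:: y; z] = [&& adj x y, adj y z, x != z & ~~ adj x z].
Proof.
apply/andP/and4P => [[/is_shortestP[]]|[adj_xy adj_yz neq_xz nadj_xz]].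
  rewrite is_path2 => /and3P[-> -> neq_xz] q_min _; split=> //.
  apply/negP=> adj_xz.
  by have := q_min [:: z]; rewrite is_path1 => /(_ adj_xz erefl).
split=> //; apply/is_shortestP; split; first by rewrite is_path2 adj_xy adj_yz.
case=> [_ /= eq_xz|w [|//]]; first by rewrite eq_xz eqxx in neq_xz.
by rewrite is_path1 => adj_xw /= eq_wz; rewrite -eq_wz adj_xw in nadj_xz.
Qed.

(** Distinct endpoints exclude the empty path, and [diam2] supplies a competitor with one or two
    edges. *)
Lemma is_geodesic_size (x : G) q : is_geodesic x q -> 0 < size q <= 2.
Proof.
case/andP=> /is_shortestP[_ q_min] neq_x.
apply/andP; split; first by case: q neq_x {q_min} => //=; rewrite eqxx.
case: (diam2 neq_x) => [adj_x|[y adj_xy adj_y]].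
  by apply: leq_trans (q_min [:: last x q] _ _) _; rewrite ?is_path1.
by apply: (q_min [:: y; last x q]); rewrite ?is_path2 ?adj_xy ?adj_y.
Qed.

Lemma path_edges1 (x y : G) : path_edges x [:: y] = [set [set x; y]].
Proof. by apply/setP=> E; rewrite !inE. Qed.

Lemma path_edges2 (x y z : G) :
  path_edges x [:: y; z] = [set [set x; y]; [set y; z]].
Proof. by apply/setP=> E; rewrite !inE. Qed.

Lemma geodesicsP (P : {set {set G}}) :
  reflect ((exists x y : G, adj x y /\ P = [set [set x; y]]) \/
           exists x y z : G, [/\ adj x y, adj y z, x != z, ~~ adj x z &
                                 P = [set [set x; y]; [set y; z]]])
          (P \in geodesics G).
Proof.
have in_geod (x : G) q : is_geodesic x q -> path_edges x q \in geodesics G.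
  move=> geod; have /andP[/is_shortestP[q_path _] _] := geod.
  by apply/imsetP; exists (x, Bseq (is_path_size q_path)); rewrite ?inE.
apply: (iffP idP) => [/imsetP[[x q]] | [[x [y [adj_xy ->]]]|]].
- rewrite inE /= => geod ->; have := is_geodesic_size geod.
  case: (val q) geod => [|y [|z [|//]]] //.
    by rewrite is_geodesic1 path_edges1; left; exists x, y.
  by rewrite is_geodesic2 path_edges2 => /and4P[]; right; exists x, y, z.
- by rewrite -path_edges1 in_geod ?is_geodesic1.
case=> [x [y [z [adj_xy adj_yz neq_xz nadj_xz ->]]]].
by rewrite -path_edges2 in_geod // is_geodesic2; apply/and4P.
Qed.

Lemma weight1 f (E : {set G}) : weight f [set E] = f E.
Proof. exact: big_set1. Qed.

Lemma weight2 f (E F : {set G}) :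
  E != F -> weight f [set E; F] = f E + f F.
Proof. by move=> neq_EF; rewrite /weight big_setU1 ?big_set1 ?inE. Qed.

(* Distinct weights force the members of s to be distinct, so s need not be
   assumed duplicate-free. *)
Lemma leech_of_enumeration f (s : seq {set {set G}}) :
  s =i geodesics G -> perm_eq (map (weight f) s) (iota 1 (size s)) ->
  geodesic_leech_labeling f.
Proof.
move=> s_geod s_perm.
have s_uniq : uniq s.
  by apply: (@map_uniq _ _ (weight f)); rewrite (perm_uniq s_perm) iota_uniq.
have s_enum : perm_eq s (enum (geodesics G)).
  by apply: uniq_perm; rewrite ?enum_uniq // => P; rewrite mem_enum.
split.
  move=> _ /imsetP[[x y] /= adj_xy ->]; rewrite inE in adj_xy.
  (* A single edge is itself a geodesic, so its label is one of the weights, all of which are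
     positive. *)
  suff : weight f [set [set x; y]] \in iota 1 (size s).
    by rewrite weight1 mem_iota => /andP[].
  rewrite -(perm_mem s_perm) map_f // s_geod.
  by apply/geodesicsP; left; exists x, y.
rewrite /t_gp cardE -(perm_size s_enum); apply: perm_trans s_perm.
by rewrite perm_sym; apply: perm_map.
Qed.

End DiameterTwo.

(** * The geodesics of a wheel *)

Section WheelGeodesics.

Variable n : nat.
Hypothesis n_ge5 : 5 <= n.

Let m := n.-1.

Lemma wheel_diam2 (x z : wheel n) :
  x != z -> adj x z \/ exists2 y, adj x y & adj y z.
Proof.
by case: x z => [i|] [j|] //= _; do ?[by left]; right; exists (None : wheel n).
Qed.

Lemma val_iter_ordS k (i : 'I_m) : iter k (@ordS m) i = (i + k) %% m :> nat.
Proof.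
elim: k => [|k IHk]; first by rewrite addn0 modn_small.
by rewrite iterS /= IHk -addn1 modnDml addn1 addnS.
Qed.

(** Since [5 <= n], the rim has at least 4 vertices, so fewer than 4 successor steps cannot close
    up. Taking [k] equal to 1 and 2 separates nearby rim vertices; 1 and 3 together show that
    vertices two steps apart are not adjacent. *)
Lemma iter_ordS_neq k (i : 'I_m) : 0 < k < 4 -> (iter k (@ordS m) i == i) = false.
Proof.
case/andP=> k_gt0 k_lt4; have m_gt3 : 3 < m by rewrite /m; case: (n) n_ge5.
have k_ltm : k < m by apply: leq_trans m_gt3.
apply/negbTE; rewrite -val_eqE /= val_iter_ordS -{2}(modn_small (ltn_ord i)).
by rewrite -{2}[val i]addn0 eqn_modDl mod0n modn_small // -lt0n.
Qed.

Lemma spoke_inj : injective (@spoke n).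
Proof.
by move=> i j /setP/(_ (Some i)); rewrite !inE eqxx => /esym/eqP[].
Qed.

Lemma rim_neq_ordS (i : 'I_m) : @rim n i != @rim n (ordS i).
Proof.
apply/eqP=> /setP/(_ (Some i)); rewrite !inE eqxx /= !(inj_eq Some_inj).
rewrite eq_sym (iter_ordS_neq (k := 1)) //.
by rewrite eq_sym (iter_ordS_neq (k := 2)).
Qed.

(** The condition [p.1 < p.2] keeps one orientation of each path through the hub. *)
Definition hub_pairs : seq ('I_m * 'I_m) :=
  [seq p : 'I_m * 'I_m <- [seq (i, j) | i <- enum 'I_m, j <- enum 'I_m]
     | (p.1 < p.2) && ~~ @adj (wheel n) (Some p.1) (Some p.2)].

(** In the last block [ordS i] is the middle vertex. On a rim of length 4 this lists both rim paths
    joining two opposite vertices. *)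
Definition wheel_geodesics : seq {set {set wheel n}} :=
  [seq [set @spoke n i] | i <- enum 'I_m] ++
  [seq [set @rim n i] | i <- enum 'I_m] ++
  [seq [set @spoke n p.1; @spoke n p.2] | p <- hub_pairs] ++
  [seq [set @rim n i; @rim n (ordS i)] | i <- enum 'I_m].

Lemma mem_hub_pairs (i j : 'I_m) :
  ((i, j) \in hub_pairs) = (i < j) && ~~ @adj (wheel n) (Some i) (Some j).
Proof.
by rewrite mem_filter /= allpairs_f ?mem_enum // andbT.
Qed.

Lemma wheel_adj_rim (i j : 'I_m) :
  @adj (wheel n) (Some i) (Some j) = (j == ordS i) || (i == ordS j).
Proof.
rewrite /adj /=; case: eqVneq => // <-.
by rewrite orbb eq_sym (iter_ordS_neq (k := 1)).
Qed.

Lemma wheel_geodesicsE : wheel_geodesics =i geodesics (wheel n).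
Proof.
move=> P.
have spokeC i : [set Some i; None] = @spoke n i by rewrite setUC.
have rimC i : [set Some (ordS i); Some i] = @rim n i by rewrite setUC.
apply/idP/(geodesicsP wheel_diam2); rewrite !mem_cat.
  case/or4P=> /mapP[].
  - by move=> i _ ->; left; exists (None : wheel n), (Some i).
  - move=> i _ ->; left; exists (Some i : wheel n), (Some (ordS i)).
    by split=> //; rewrite wheel_adj_rim eqxx.
  - case=> i j; rewrite mem_hub_pairs => /andP[lt_ij nadj_ij] ->; right.
    exists (Some i : wheel n), (None : wheel n), (Some j); split=> //.
      by rewrite (inj_eq Some_inj) neq_ltn lt_ij.
    by rewrite spokeC.
  move=> i _ ->; right.
  exists (Some i : wheel n), (Some (ordS i)), (Some (ordS (ordS i))); split=> //.
  - by rewrite wheel_adj_rim eqxx.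
  - by rewrite wheel_adj_rim eqxx.
  - by rewrite (inj_eq Some_inj) eq_sym (iter_ordS_neq (k := 2)).
  rewrite wheel_adj_rim (inj_eq (@ordS_inj _)).
  by rewrite (iter_ordS_neq (k := 1)) // eq_sym (iter_ordS_neq (k := 3)).
(* The hub is adjacent to every other vertex, so a geodesic with two edges has both ends on the
   rim. *)
case=> [[[i|] [[j|] []]] // | [[i|] [y [[j|] []]]] //].
- rewrite wheel_adj_rim => /orP[] /eqP -> ->; apply/or4P; apply: Or42.
    by rewrite map_f ?mem_enum.
  by rewrite rimC map_f ?mem_enum.
- by move=> _ ->; rewrite spokeC map_f ?mem_enum.
- by move=> _ ->; rewrite -/(@spoke n j) map_f ?mem_enum.
(* The middle vertex is either the hub, giving a pair of spokes, or a rim vertex. *)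
case: y => [k|]; last first.
  move=> _ _; rewrite (inj_eq Some_inj) neq_ltn.
  move=> lt_ij nadj_ij ->; rewrite spokeC -/(@spoke n j).
  apply/or4P; apply: Or43; case/orP: lt_ij => [lt_ij|lt_ji].
    by apply/mapP; exists (i, j); rewrite ?mem_hub_pairs ?lt_ij.
  apply/mapP; exists (j, i); last by rewrite setUC.
  by rewrite mem_hub_pairs lt_ji adj_sym.
rewrite !wheel_adj_rim (inj_eq Some_inj).
(* Each of the two steps goes forward or backward. Opposite directions return to the start, against
   [neq_ij]; two backward steps are the forward path from [j] reversed. *)
move=> /orP[]/eqP ek /orP[]/eqP ej neq_ij _ ->; apply/or4P; apply: Or44.
- by apply/mapP; exists i; rewrite ?mem_enum // ej ek.
- by move: neq_ij; rewrite -(inj_eq (@ordS_inj _)) -ek -ej eqxx.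
- by rewrite ek ej eqxx in neq_ij.
apply/mapP; exists j; rewrite ?mem_enum // ek ej.
by rewrite !rimC setUC.
Qed.

End WheelGeodesics.

(** * Weights of the geodesics, computed on natural numbers *)

(* Here m is the length of the rim: m = n - 1 for the wheel W_n. *)
Definition wheel_weights (m : nat) (A B : seq nat) : seq nat :=
  [seq nth 0 A i | i <- iota 0 m] ++
  [seq nth 0 B i | i <- iota 0 m] ++
  [seq nth 0 A p.1 + nth 0 A p.2
     | p <- [seq (i, j) | i <- iota 0 m, j <- iota 0 m]
     & (p.1 < p.2) && ~~ ((p.2 == p.1.+1 %% m) || (p.1 == p.2.+1 %% m))] ++
  [seq nth 0 B i + nth 0 B (i.+1 %% m) | i <- iota 0 m].

(** The right-hand side involves only [iota] and arithmetic on [nat], so it evaluates on closed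
    arguments. Two-edge paths contribute sums because their edges are distinct. *)
Lemma wheel_weightsE n A B : 5 <= n ->
  [seq weight (@wheel_labeling n A B) P | P <- wheel_geodesics n] =
  wheel_weights n.-1 A B.
Proof.
move=> n_ge5; have n_ge4 := ltnW n_ge5.
rewrite !map_cat /wheel_weights -val_enum_ord.
congr (_ ++ (_ ++ (_ ++ _))).
- rewrite -!map_comp; apply: eq_map => i /=.
  by rewrite weight1 wheel_labeling_spoke.
- rewrite -!map_comp; apply: eq_map => i /=.
  by rewrite weight1 wheel_labeling_rim.
- rewrite allpairs_mapl allpairs_mapr.
  (* Projecting pairs of ordinals to pairs of numbers lets the two filters be compared. *)
  pose valp (p : 'I_n.-1 * 'I_n.-1) := (val p.1, val p.2).
  rewrite -(map_allpairs valp pair) filter_map -[LHS]map_comp -[RHS]map_comp /hub_pairs.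
  under [in RHS]eq_filter => p do rewrite /= -(wheel_adj_rim n_ge5).
  (* Membership is kept because distinctness of the two spokes comes from [i < j]. *)
  apply/eq_in_map => -[i j]; rewrite mem_filter /= => /andP[/andP[lt_ij _] _].
  rewrite weight2 ?wheel_labeling_spoke // (inj_eq (@spoke_inj n)).
  by rewrite neq_ltn lt_ij.
rewrite -!map_comp; apply: eq_map => i /=.
by rewrite weight2 ?rim_neq_ordS // !wheel_labeling_rim.
Qed.

Lemma wheel_leech n A B : 5 <= n ->
  perm_eq (wheel_weights n.-1 A B) (iota 1 (size (wheel_weights n.-1 A B))) ->
  geodesic_leech_labeling (@wheel_labeling n A B).
Proof.
move=> n_ge5; rewrite -wheel_weightsE // size_map.
apply: leech_of_enumeration (wheel_geodesicsE n_ge5); exact: wheel_diam2.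
Qed.

Theorem theorem9p1 :
  (geodesic_leech_labeling (@wheel_labeling 5
     [:: 6; 2; 7; 3]
     [:: 1; 10; 4; 8]) /\
   geodesic_leech_labeling (@wheel_labeling 6
     [:: 14; 7; 6; 5; 11]
     [:: 1; 3; 13; 2; 8]) /\
   geodesic_leech_labeling (@wheel_labeling 7
     [:: 4; 5; 2; 14; 22; 7]
     [:: 15; 8; 17; 3; 10; 1]) /\
   geodesic_leech_labeling (@wheel_labeling 8
     [:: 9; 6; 7; 21; 13; 8; 5]
     [:: 10; 24; 4; 31; 1; 2; 23]) /\
   geodesic_leech_labeling (@wheel_labeling 9
     [:: 5; 8; 1; 13; 34; 28; 9; 3]
     [:: 12; 20; 24; 2; 25; 15; 23; 7]) /\
   geodesic_leech_labeling (@wheel_labeling 10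
     [:: 15; 4; 19; 39; 29; 1; 7; 13; 2]
     [:: 8; 10; 35; 12; 25; 24; 27; 23; 30]) /\
   geodesic_leech_labeling (@wheel_labeling 11
     [:: 1; 32; 33; 16; 22; 9; 27; 4; 29; 31]
     [:: 2; 44; 21; 18; 6; 8; 3; 12; 7; 50]) /\
   geodesic_leech_labeling (@wheel_labeling 12
     [:: 10; 31; 17; 22; 26; 13; 38; 39; 2; 37; 3]
     [:: 1; 8; 66; 11; 7; 14; 58; 4; 67; 6; 45]) /\
   geodesic_leech_labeling (@wheel_labeling 13
     [:: 25; 10; 36; 16; 30; 44; 2; 42; 3; 43; 46; 21]
     [:: 4; 7; 15; 74; 1; 34; 50; 20; 9; 8; 6; 77])) /\
  (forall n : nat, 5 <= n <= 13 -> geodesic_leech (wheel n)).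
Proof.
match goal with |- ?T /\ _ => have all_leech : T end.
  (* Each remaining [perm_eq] concerns closed lists of numbers and is decided by evaluation. *)
  by do 8![split; first by apply: wheel_leech]; apply: wheel_leech.
split=> // n.
move: all_leech => [L5 [L6 [L7 [L8 [L9 [L10 [L11 [L12 L13]]]]]]]].
(* Values below 5 and above 13 contradict the bounds; otherwise the matching hypothesis determines
   the labeling. *)
by do 14?[case: n => [|n] //]; move=> _; eexists; eassumption.
Qed.
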